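(* Let $l\ge1$ and let $\psi^{(1)},\ldots,\psi^{(l)}$ be $l$ generic matricial polynomial functions of two matricial indeterminates $(\zeta,\xi)\in(\mathbb{C}^{d\times d})^2$, and set $\psi^{(k)}_{i,j}(\zeta,\xi)=(\psi^{(k)}(\zeta,\xi))_{ij}$. Then the set of couples $(\zeta,\xi)\in(\mathbb{C}^{d\times d})^2$ such that $$\psi^{(k)}_{i,j}(\zeta,\xi)\neq 0\ \text{ for all } 1\le i,j\le d,\ 1\le k\le l,\qquad\text{and}\qquad \det(\psi^{(k)}(\zeta,\xi))\neq 0\ \text{ for all } 1\le k\le l,$$ is an open dense subset of $(\mathbb{C}^{d\times d})^2$.
   Context: A matricial polynomial function of two matricial indeterminates $(\zeta,\xi)$ is an expression given by a finite sum $$\psi(\zeta,\xi)=\sum \kappa_{m_1,m_2,\ldots}\,\zeta^{m_1}\xi^{m_2}\zeta^{m_3}\xi^{m_4}\cdots$$ with coefficients $\kappa_{m_1,m_2,\ldots}\in\mathbb{C}$, where the monomials are noncommutative words in $\zeta,\xi$ (the sum runs over pairwise distinct words; the first exponent $m_1$ may be $0$, so that words may begin with $\xi$); it is evaluated at pairs of matrices in $\mathbb{C}^{d\times d}$ (the empty word being evaluated as the identity matrix $I_d$). For $(p,q)\in\mathbb{N}^2$, let $K_{pq}$ be the sum of all the coefficients $\kappa_{m_1,m_2,\ldots}$ such that $m_1+m_3+\cdots=p$ and $m_2+m_4+\cdots=q$. For $(p,q,r,s)\in\mathbb{N}^4$, let $\tilde K_{p,q,r,s}$ be the sum of all the quantities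 $m_1\times m_2\times\cdots\times\kappa_{m_1,m_2,\ldots}$ such that $m_1+m_3+\cdots=p$, $m_2+m_4+\cdots=q$, and where $r$ and $s$ count the occurrences of $\zeta$ and of $\xi$ respectively in the monomial $\zeta^{m_1}\xi^{m_2}\zeta^{m_3}\cdots$ (i.e. the number of power blocks $\zeta^{m}$, respectively $\xi^{m}$, with $m\ge 1$; the product $m_1\times m_2\times\cdots$ is taken over the exponents of the blocks that are present). The function $\psi$ is called generic when at least one sum $K_{pq}$ and at least one sum $\tilde K_{p,q,r,s}$ are nonzero.
   Formalization: ''Generic'' is taken to require a nonzero sum K_pq for some (p,q) ≠ (0,0): if K_00 alone could witness genericity, the claim would fail, e.g. for ψ = 1 with d ≥ 2, whose off-diagonal entries vanish identically. *)

(* Defs.v *)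
From HB Require Import structures.
From mathcomp Require Import all_boot all_order all_algebra finmap.
From mathcomp Require Import all_classical all_reals all_analysis.
From mathcomp Require Import complex.

Set Implicit Arguments.
Unset Strict Implicit.
Unset Printing Implicit Defensive.

Import GRing.Theory.
Local Open Scope ring_scope.
Local Open Scope complex_scope.

(* MathComp-Analysis gives every numFieldType K its norm topology on K^o; this
   makes that topology (here the usual one of the complex plane) available on
   R[i] itself, hence on the matrices 'M[R[i]]_d and on pairs of them. *)
HB.instance Definition _ (R : realType) := PseudoPointedMetric.copy R[i] R[i]^o.

(* A noncommutative monomial is a word whose letters are booleans: [true] stands
   for zeta and [false] for xi. The empty word is the monomial 1. *)
Definition word := seq bool.

(* Run-length encoding: zeta^m1 xi^m2 zeta^m3 ... is the list of its maximal
   power blocks (true, m1), (false, m2), (true, m3), ..., where all the listed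
   exponents are at least 1 and the first block may be a power of xi. *)
Fixpoint blocks (w : word) : seq (bool * nat) :=
  if w is x :: w' then
    if blocks w' is (y, m) :: bs then
      if x == y then (y, m.+1) :: bs else (x, 1%N) :: (y, m) :: bs
    else [:: (x, 1%N)]
  else [::].

Definition zeta_degree (w : word) : nat :=
  \sum_(b <- blocks w | b.1) b.2.

Definition xi_degree (w : word) : nat :=
  \sum_(b <- blocks w | ~~ b.1) b.2.

Definition zeta_blocks (w : word) : nat := count (fun b => b.1) (blocks w).

Definition xi_blocks (w : word) : nat := count (fun b => ~~ b.1) (blocks w).

(* The empty word gives the empty product 1. *)
Definition exponent_product (w : word) : nat := \prod_(b <- blocks w) b.2.

(* The finitely supported family kappa of the coefficients. *)
Definition matpoly (R : realType) := {fsfun word -> R[i] with 0}.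

Definition word_eval (R : realType) (d : nat) (zeta xi : 'M[R[i]]_d)
    (w : word) : 'M[R[i]]_d :=
  \prod_(b <- blocks w) (if b.1 then zeta else xi) ^+ b.2.

Definition matpoly_eval (R : realType) (d : nat) (psi : matpoly R)
    (zeta xi : 'M[R[i]]_d) : 'M[R[i]]_d :=
  \sum_(w <- finsupp psi) psi w *: word_eval zeta xi w.

Definition K (R : realType) (psi : matpoly R) (p q : nat) : R[i] :=
  \sum_(w <- finsupp psi | (zeta_degree w == p) && (xi_degree w == q)) psi w.

Definition Ktilde (R : realType) (psi : matpoly R) (p q r s : nat) : R[i] :=
  \sum_(w <- finsupp psi |
        [&& zeta_degree w == p, xi_degree w == q,
            zeta_blocks w == r & xi_blocks w == s])
    (exponent_product w)%:R * psi w.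

(* The constant coefficient K psi 0 0 does not count for genericity: otherwise
   psi = 1, and for d = 2 also psi = 1 + (zeta xi - xi zeta)^2, would be generic,
   although their values are always scalar matrices. *)
Definition generic (R : realType) (psi : matpoly R) : Prop :=
  (exists p q : nat, (p, q) <> (0%N, 0%N) /\ K psi p q <> 0) /\
  (exists p q r s : nat, Ktilde psi p q r s <> 0).

(* Main.v *)
(* The coordinates and the determinants of the psi k are polynomial functions
   on pairs of matrices. Restricted to a line such a function is a univariate
   polynomial, so it vanishes either everywhere or on a set with dense open
   complement; it remains to find one point where each of them is nonzero.
   At diagonal matrices, psi takes the value f(z_j, x_j) at the j-th diagonal
   position, where f has the coefficients K psi p q. Genericity makes f
   nonconstant, so scalar matrices settle the determinants and the diagonal
   coordinates. For the coordinate (i, j) with i <> j, conjugate by 1 + E_ij a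
   diagonal pair at which f has distinct values in positions i and j: as
   psi commutes with simultaneous conjugation, the coordinate (i, j) of its
   value is the difference of these two values of f. *)
Require Import Defs.
From mathcomp Require Import all_boot all_order all_algebra finmap.
From mathcomp Require Import all_classical all_reals all_analysis.
From mathcomp Require Import complex.
Import Order.TTheory GRing.Theory Num.Theory numFieldNormedType.Exports.
Local Open Scope classical_set_scope.
Local Open Scope ring_scope.
Local Open Scope complex_scope.

Lemma affine_continuous (K : numFieldType) (a b : K) :
  continuous (fun t : K => a + t * b).
Proof.
move=> t; apply: (@cvgD K K^o K (nbhs t) _ (fun=> a)); first exact: cvg_cst.
by apply: (@cvgM K K (nbhs t) _ id); [exact: cvg_id|exact: cvg_cst].
Qed.

(** * Polynomial functions on pairs of matrices *)

Section PolyFun.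
Context {R : realType} {d : nat}.
Local Notation V := ('M[R[i]]_d * 'M[R[i]]_d)%type.

(** Generating these functions from constants and coordinates, rather than evaluating formal
    polynomials in many variables, lets continuity and restriction to lines go by induction on the
    derivation. *)
Inductive polyfun : (V -> R[i]) -> Prop :=
| PolyCst c : polyfun (fun=> c)
| PolyFst i j : polyfun (fun u => u.1 i j)
| PolySnd i j : polyfun (fun u => u.2 i j)
| PolyAdd f g : polyfun f -> polyfun g -> polyfun (fun u => f u + g u)
| PolyMul f g : polyfun f -> polyfun g -> polyfun (fun u => f u * g u).

Lemma polyfun_sum (I : Type) (r : seq I) (P : pred I) (f : I -> V -> R[i]) :
  (forall i, polyfun (f i)) -> polyfun (fun u => \sum_(i <- r | P i) f i u).
Proof.
move=> pf; elim: r => [|i r IH].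
  by under eq_fun do rewrite big_nil; apply: PolyCst.
under eq_fun do rewrite big_cons.
by case: (P i) => //; apply: PolyAdd.
Qed.

Lemma polyfun_prod (I : Type) (r : seq I) (f : I -> V -> R[i]) :
  (forall i, polyfun (f i)) -> polyfun (fun u => \prod_(i <- r) f i u).
Proof.
move=> pf; elim: r => [|i r IH].
  by under eq_fun do rewrite big_nil; apply: PolyCst.
by under eq_fun do rewrite big_cons; apply: PolyMul.
Qed.

Lemma polyfun_det (A : V -> 'M[R[i]]_d) :
  (forall i j, polyfun (fun u => A u i j)) -> polyfun (fun u => \det (A u)).
Proof.
move=> pA; apply: polyfun_sum => s; apply: PolyMul; first exact: PolyCst.
exact: polyfun_prod.
Qed.

Lemma polyfun_mulmx (A B : V -> 'M[R[i]]_d) :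
  (forall i j, polyfun (fun u => A u i j)) ->
  (forall i j, polyfun (fun u => B u i j)) ->
  forall i j, polyfun (fun u => (A u * B u) i j).
Proof.
move=> pA pB i j; under eq_fun do rewrite mxE.
by apply: polyfun_sum => k; apply: PolyMul.
Qed.

Lemma polyfun_word_eval w i j : polyfun (fun u => word_eval u.1 u.2 w i j).
Proof.
rewrite /word_eval; elim: (blocks w) i j => [|[b m] bs IH] i j.
  by under eq_fun do rewrite big_nil; apply: PolyCst.
under eq_fun do rewrite big_cons.
apply: polyfun_mulmx i j => // i j; elim: m i j => [|m IHm] i j /=.
  by under eq_fun do rewrite expr0; apply: PolyCst.
under eq_fun do rewrite exprS.
apply: polyfun_mulmx i j => // i j.
by case: (b) => /=; [apply: PolyFst|apply: PolySnd].
Qed.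

Lemma polyfun_matpoly_eval (psi : matpoly R) i j :
  polyfun (fun u => matpoly_eval psi u.1 u.2 i j).
Proof.
rewrite /matpoly_eval; under eq_fun do rewrite summxE.
apply: polyfun_sum => w; under eq_fun do rewrite mxE.
by apply: PolyMul; [apply: PolyCst|apply: polyfun_word_eval].
Qed.

Lemma polyfun_continuous f : polyfun f -> continuous (f : V -> R[i]^o).
Proof.
elim=> [c|i j|i j|g h _ cg _ ch|g h _ cg _ ch] u.
- exact: cvg_cst.
- apply: (@continuous_comp _ _ _ fst (fun M : 'M[R[i]^o]_d => M i j)).
    exact: cvg_fst.
  exact: coord_continuous.
- apply: (@continuous_comp _ _ _ snd (fun M : 'M[R[i]^o]_d => M i j)).
    exact: cvg_snd.
  exact: coord_continuous.
- exact: (cvgD (cg u) (ch u)).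
- exact: (cvgM (cg u) (ch u)).
Qed.

Lemma open_polyfun_neq0 f : polyfun f -> open [set u | f u <> 0].
Proof.
move=> /polyfun_continuous cf.
have -> : [set u | f u <> 0] = f @^-1` [set z : R[i]^o | z != 0].
  by apply/seteqP; split=> u /= /eqP.
have -> : [set z : R[i]^o | z != 0] = ~` [set 0].
  by apply/seteqP; split=> z /= /eqP.
apply: open_comp => [u _|]; first exact: cf.
apply/closed_openC/accessible_closed_set1/hausdorff_accessible.
exact: (@norm_hausdorff _ R[i]^o).
Qed.

Definition line (u v : V) (t : R[i]) : V :=
  (u.1 + t *: (v.1 - u.1), u.2 + t *: (v.2 - u.2)).

Lemma line0 u v : line u v 0 = u.
Proof. by rewrite /line !scale0r !addr0; case: u. Qed.

Lemma line1 u v : line u v 1 = v.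
Proof. by rewrite /line !scale1r ![_ + (_ - _)]addrC !subrK; case: v. Qed.

Lemma polyfun_line f u v :
  polyfun f -> exists p : {poly R[i]}, forall t, f (line u v t) = p.[t].
Proof.
elim=> [c|i j|i j|g h _ [p pg] _ [q qh]|g h _ [p pg] _ [q qh]].
- by exists c%:P => t; rewrite hornerC.
- exists ((u.1 i j)%:P + 'X * (v.1 i j - u.1 i j)%:P) => t.
  by rewrite !mxE !hornerE.
- exists ((u.2 i j)%:P + 'X * (v.2 i j - u.2 i j)%:P) => t.
  by rewrite !mxE !hornerE.
- by exists (p + q) => t; rewrite hornerD pg qh.
- by exists (p * q) => t; rewrite hornerM pg qh.
Qed.

Lemma line_continuous u v : continuous (line u v : R[i]^o -> V).
Proof.
have cl (A B : 'M[R[i]]_d) :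
    continuous ((fun t => A + t *: (B - A)) : R[i]^o -> 'M[R[i]]_d).
  (* A neighbourhood of a matrix contains a box [P] of neighbourhoods of its entries. Each entry of
     the line is affine in [t], and finitely many entries have to be controlled. *)
  move=> t U [P nP PU].
  have : \forall s \near (t : R[i]^o),
      forall i j, P i j ((A + s *: (B - A)) i j).
    apply: (@filter_forall _ _ _ (nbhs (t : R[i]^o))) => i.
    apply: (@filter_forall _ _ _ (nbhs (t : R[i]^o))) => j.
    have := nP i j; rewrite !mxE.
    move=> /(affine_continuous _ (A i j) (B i j - A i j) t).
    apply: (@filterS _ (nbhs (t : R[i]^o))) => s /=.
    by rewrite !mxE.
  by apply: (@filterS _ (nbhs (t : R[i]^o))) => s Ps; exact: PU.
by move=> t; exact: (cvg_pair (cl u.1 v.1 t) (cl u.2 v.2 t)).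
Qed.

End PolyFun.

(** * Density of nonvanishing sets *)

Lemma poly_nonroot_ball (K : numFieldType) (p : {poly K}) (e : K) :
  0 < e -> p != 0 -> exists t, `|t| < e /\ p.[t] != 0.
Proof.
(* Infinitely many distinct points of the ball, too many to be roots of [p]; [n.+2] keeps [t 0]
   strictly below [e]. *)
move=> e0 p0; pose t n : K := e / n.+2%:R.
have [[n pn]|noroot] := pselect (exists n, p.[t n] != 0).
  exists (t n); split=> //.
  rewrite gtr0_norm ?divr_gt0 ?ltr0n// ltr_pdivrMr ?ltr0n//.
  by rewrite ltr_pMr// ltr1n.
have rt : all (root p) (mkseq t (size p)).
  apply/allP => _ /mapP[n _ ->]; apply/eqP.
  by apply: contrapT => /eqP pn; apply: noroot; exists n.
have ut : uniq (mkseq t (size p)).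
  rewrite map_inj_uniq ?iota_uniq// => m n /(mulfI (lt0r_neq0 e0)).
  by move=> /invr_inj/eqP; rewrite eqr_nat => /eqP[].
by have := max_poly_roots p0 rt ut; rewrite size_mkseq ltnn.
Qed.

Lemma poly_nonroot (K : numFieldType) (p : {poly K}) :
  p != 0 -> exists t, p.[t] != 0.
Proof. by move=> /(poly_nonroot_ball _ _ _ ltr01)[t [_ pt]]; exists t. Qed.

Section Nonzero.
Context {R : realType} {d : nat}.
Local Notation V := ('M[R[i]]_d * 'M[R[i]]_d)%type.
Implicit Types f g : V -> R[i].

Lemma dense_polyfun_neq0 f :
  polyfun f -> (exists u, f u <> 0) -> dense [set u | f u <> 0].
Proof.
move=> pf [v fv] O [u Ou] oO.
have [p fp] := polyfun_line f u v pf.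
have p0 : p != 0.
  by apply/eqP => p0; apply: fv; rewrite -(line1 u v) fp p0 horner0.
(* The line starts at [u] in [O], so small parameters stay in [O]; one of them avoids the roots of
   [p]. *)
have : nbhs (0 : R[i]^o) (line u v @^-1` O).
  by apply: line_continuous; rewrite line0; apply: open_nbhs_nbhs.
move=> /nbhs_ballP[e /= e0 eO].
have [t [te pt]] := poly_nonroot_ball _ _ _ e0 p0.
exists (line u v t); split; last by rewrite /= fp; exact/eqP.
by apply: eO; rewrite /ball /= sub0r normrN.
Qed.

(** By induction on the factors: the set where the product so far is nonzero is open and nonempty,
    hence meets the dense set where the next factor is nonzero. *)
Lemma polyfun_prod_neq0 (I : finType) (f : I -> V -> R[i]) :
  (forall i, polyfun (f i)) -> (forall i, exists u, f i u <> 0) ->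
  exists u, \prod_i f i u <> 0.
Proof.
move=> pf nf; elim: (index_enum I) => [|i r [u nu]].
  by exists 0; rewrite big_nil; apply/eqP; rewrite oner_eq0.
have [v [/= nv nv']] : [set u | \prod_(i <- r) f i u <> 0]
    `&` [set u | f i u <> 0] !=set0.
  apply: (dense_polyfun_neq0 _ (pf i) (nf i)); first by exists u.
  exact/open_polyfun_neq0/polyfun_prod.
by exists v; rewrite big_cons => /eqP; rewrite mulf_eq0 => /orP[]/eqP.
Qed.

End Nonzero.

(** * Values at commuting scalars *)

Section Values.
Context {R : realType}.
Implicit Types psi : matpoly R.

(** At commuting arguments, words of equal bidegree merge, so the coefficient of [a ^+ p * b ^+ q]
    is [K psi p q]. *)
Definition scalar_eval psi (a b : R[i]) : R[i] :=
  \sum_(w <- finsupp psi) psi w * (a ^+ zeta_degree w * b ^+ xi_degree w).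

Lemma scalar_eval_nonconstant psi p q :
  (p, q) <> (0%N, 0%N) -> K psi p q <> 0 ->
  exists a b, scalar_eval psi a b <> scalar_eval psi 0 0.
Proof.
move=> pq0 Kpq.
pose A w : {poly R[i]} := psi w *: 'X^(zeta_degree w).
(* The outer variable stands for [b], the inner one for [a]. The value at the origin is subtracted,
   so a pair where [Q] is nonzero is a pair where the value differs. *)
pose Q : {poly {poly R[i]}} :=
  \sum_(w <- finsupp psi) A w *: 'X^(xi_degree w) - (scalar_eval psi 0 0)%:P%:P.
have Qpq : Q`_q`_p = K psi p q.
  rewrite coefB coefC coef_sum coefB coef_sum.
  (* The subtracted constant affects only the coefficient of bidegree (0, 0), which [pq0]
     excludes. *)
  have -> : (if q == 0%N then (scalar_eval psi 0 0)%:P else 0)`_p = 0.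
    case: eqP => [q0|]; rewrite ?coef0// coefC.
    by case: eqP => // p0; case: pq0; rewrite p0 q0.
  rewrite subr0 /K [RHS]big_mkcond; apply: eq_bigr => w _.
  rewrite coefZ coefXn (eq_sym q); case: (xi_degree w == q).
    rewrite mulr1 coefZ coefXn (eq_sym p) andbT.
    by case: (_ == p); rewrite ?mulr1 ?mulr0.
  by rewrite mulr0 coef0 andbF.
(* Specialise one variable at a time: [a] keeps the outer coefficient of index [q] nonzero, then [b]
   avoids the roots of the specialised polynomial. *)
have [a Qa] : exists a, (Q`_q).[a] != 0.
  by apply: poly_nonroot; apply/eqP => Q0; apply: Kpq; rewrite -Qpq Q0 coef0.
have [b Qb] : exists b, (map_poly (horner_eval a) Q).[b] != 0.
  apply: poly_nonroot; apply: contra_neq Qa => Q0.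
  by rewrite -[_.[a]]/(horner_eval a _) -coef_map Q0 coef0.
exists a, b => ab; case/eqP: Qb.
(* Writing [b] as the image of a constant polynomial lets [horner_map] evaluate [Q] at [b%:P] first
   and at [a] afterwards. *)
have -> : b = horner_eval a b%:P by rewrite /horner_eval hornerC.
rewrite horner_map /horner_eval /Q !(hornerD, hornerN, hornerC) horner_sum.
rewrite rmorphB/= /horner_eval hornerC -ab horner_sum -sumrB big1// => w _.
rewrite hornerZ hornerXn hornerM /A hornerZ hornerXn horner_exp hornerC.
by rewrite mulrA subrr.
Qed.

(** * Values at diagonal matrices and their conjugates *)

Section Matrices.
Context {d : nat}.
Implicit Types (z x : 'rV[R[i]]_d) (A B P Q : 'M[R[i]]_d).

Lemma expr_diag_mx z n : diag_mx z ^+ n = diag_mx (\row_j z 0 j ^+ n).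
Proof.
elim: n => [|n IH].
  by rewrite expr0; apply/matrixP => i j; rewrite !mxE expr0.
rewrite exprS IH [LHS]mulmx_diag; congr diag_mx.
by apply/rowP => j; rewrite !mxE exprS.
Qed.

Lemma word_eval_diag z x w :
  word_eval (diag_mx z) (diag_mx x) w =
  diag_mx (\row_j (z 0 j ^+ zeta_degree w * x 0 j ^+ xi_degree w)).
Proof.
rewrite /word_eval /zeta_degree /xi_degree.
elim: (blocks w) => [|[b m] bs IH].
  by apply/matrixP => i j; rewrite !big_nil !mxE mulr1.
rewrite !big_cons IH /=; case: b => /=; rewrite expr_diag_mx [LHS]mulmx_diag;
  congr diag_mx; apply/rowP => j; rewrite !mxE exprD.
  by rewrite mulrA.
by rewrite mulrCA.
Qed.

Lemma matpoly_eval_diag psi z x :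
  matpoly_eval psi (diag_mx z) (diag_mx x) =
  diag_mx (\row_j scalar_eval psi (z 0 j) (x 0 j)).
Proof.
rewrite /matpoly_eval; apply/matrixP => i j; rewrite summxE !mxE /scalar_eval.
rewrite -sumrMnl; apply: eq_bigr => w _.
by rewrite word_eval_diag !mxE mulrnAr.
Qed.

Lemma expr_conj P Q A n : P * Q = 1 -> Q * P = 1 ->
  (P * A * Q) ^+ n = P * A ^+ n * Q.
Proof.
move=> PQ QP; elim: n => [|n IH]; first by rewrite !expr0 mulr1.
by rewrite !exprS IH !mulrA -[_ * Q * P]mulrA QP mulr1.
Qed.

Lemma word_eval_conj P Q A B w : P * Q = 1 -> Q * P = 1 ->
  word_eval (P * A * Q) (P * B * Q) w = P * word_eval A B w * Q.
Proof.
move=> PQ QP; rewrite /word_eval.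
elim: (blocks w) => [|[b m] bs IH]; first by rewrite !big_nil mulr1.
rewrite !big_cons IH -[if b then _ else _](fun_if (fun C => P * C * Q)).
by rewrite expr_conj// !mulrA -[_ * Q * P]mulrA QP mulr1.
Qed.

Lemma matpoly_eval_conj psi P Q A B : P * Q = 1 -> Q * P = 1 ->
  matpoly_eval psi (P * A * Q) (P * B * Q) = P * matpoly_eval psi A B * Q.
Proof.
move=> PQ QP; rewrite /matpoly_eval mulr_sumr mulr_suml.
apply: eq_bigr => w _; rewrite word_eval_conj//.
by rewrite -[P * (_ *: _)]scalemxAr -[RHS]scalemxAl.
Qed.

(** A nonconstant function is nonzero at the origin or, failing that, wherever it differs from its
    value there. *)
Lemma generic_scalar_eval_neq0 psi : generic psi ->
  exists a b : R[i], scalar_eval psi a b <> 0.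
Proof.
move=> [[p [q [pq0 Kpq]]] _].
have [a [b ab]] := scalar_eval_nonconstant _ _ _ pq0 Kpq.
have [e0|] := pselect (scalar_eval psi 0 0 = 0); last by exists 0, 0.
by exists a, b; rewrite -e0.
Qed.

Lemma generic_det_neq0 psi : generic psi ->
  exists u : 'M[R[i]]_d * 'M[R[i]]_d, \det (matpoly_eval psi u.1 u.2) <> 0.
Proof.
move=> /generic_scalar_eval_neq0[a [b ab]].
exists (diag_mx (const_mx a), diag_mx (const_mx b)).
rewrite matpoly_eval_diag det_diag; apply/eqP/prodf_neq0 => i _.
by rewrite !mxE; apply/eqP.
Qed.

Lemma generic_entry_neq0 psi (i j : 'I_d) : generic psi ->
  exists u : 'M[R[i]]_d * 'M[R[i]]_d, matpoly_eval psi u.1 u.2 i j <> 0.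
Proof.
move=> gpsi; have [<-|ij] := eqVneq i j.
  have [a [b ab]] := generic_scalar_eval_neq0 _ gpsi.
  exists (diag_mx (const_mx a), diag_mx (const_mx b)).
  by rewrite matpoly_eval_diag !mxE eqxx.
case: gpsi => [[p [q [pq0 Kpq]]] _].
have [a [b ab]] := scalar_eval_nonconstant _ _ _ pq0 Kpq.
pose E : 'M[R[i]]_d := delta_mx i j.
have EE : E * E = 0 by rewrite [LHS]mul_delta_mx_0// eq_sym.
have EE' c : c *: E * E = 0 by rewrite -[LHS]scalemxAl [_ *m _]EE scaler0.
(* Since [i] and [j] differ, [E] squares to zero, which makes [1 - E] the inverse of [1 + E]. *)
have PQ : (1 + E) * (1 - E) = 1.
  by rewrite mulrDl !mulrBr !mul1r !mulr1 EE subr0 subrK.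
have QP : (1 - E) * (1 + E) = 1.
  by rewrite mulrBl !mulrDr !mul1r !mulr1 EE addr0 addrK.
have ED (v : 'rV[R[i]]_d) : E * diag_mx v = v 0 j *: E.
  rewrite [LHS]mul_mx_diag; apply/matrixP => k m; rewrite !mxE mulrC.
  by case: (m =P j) => [->//|_]; rewrite andbF !mulr0.
have DE (v : 'rV[R[i]]_d) : diag_mx v * E = v 0 i *: E.
  rewrite [LHS]mul_diag_mx; apply/matrixP => k m; rewrite !mxE.
  by case: (k =P i) => [->//|_]; rewrite !mulr0.
(* The pair [(a, b)] sits at position [j] and [(0, 0)] at all others, in particular at [i]. *)
pose z : 'rV[R[i]]_d := \row_k (if k == j then a else 0).
pose x : 'rV[R[i]]_d := \row_k (if k == j then b else 0).
exists ((1 + E) * diag_mx z * (1 - E), (1 + E) * diag_mx x * (1 - E)).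
rewrite matpoly_eval_conj// matpoly_eval_diag.
set v := \row__ _.
(* With D the diagonal matrix, the product expands to D + ED - DE - EDE, and EDE is a multiple of
   the square of [E], hence zero. *)
have -> : (1 + E) * diag_mx v * (1 - E) = diag_mx v + (v 0 j - v 0 i) *: E.
  rewrite mulrDl mul1r ED mulrBr mulr1 mulrDl DE EE' addr0.
  by rewrite scalerBl addrA.
rewrite !mxE !eqxx (negPf ij) mulr1 add0r => /eqP.
by rewrite subr_eq0 => /eqP.
Qed.

End Matrices.
End Values.

Theorem theorem4p1 (R : realType) (d l : nat) (psi : 'I_l -> matpoly R)
    (hd : (1 <= d)%N) (hl : (1 <= l)%N) (hpsi : forall k : 'I_l, generic (psi k)) :
  let S : set ('M[R[i]]_d * 'M[R[i]]_d) :=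
    [set u | (forall (k : 'I_l) (i j : 'I_d),
                matpoly_eval (psi k) u.1 u.2 i j <> 0) /\
             (forall k : 'I_l, \det (matpoly_eval (psi k) u.1 u.2) <> 0)] in
  open S /\ dense S.
Proof.
move=> S.
(* All conditions form one finite family: [Some (i, j)] indexes a coordinate, [None] the
   determinant. Their conjunction then says that a single polynomial function, the product, is
   nonzero. *)
pose f (c : 'I_l * option ('I_d * 'I_d)) (u : 'M[R[i]]_d * 'M[R[i]]_d) :=
  let A := matpoly_eval (psi c.1) u.1 u.2 in
  if c.2 is Some (i, j) then A i j else \det A.
have pf c : polyfun (f c).
  case: c => k [[i j]|]; first exact: polyfun_matpoly_eval.
  by apply: polyfun_det => i j; apply: polyfun_matpoly_eval.
have nf c : exists u, f c u <> 0.
  case: c => k [[i j]|]; first exact: generic_entry_neq0.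
  exact: generic_det_neq0.
have -> : S = [set u | \prod_c f c u <> 0].
  apply/seteqP; split=> u /= => [[Sij Sdet]|/eqP/prodf_neq0 fu].
    by apply/eqP/prodf_neq0 => -[k [[i j]|]] _; apply/eqP; [exact: Sij|exact: Sdet].
  split=> [k i j|k]; first by apply/eqP; apply: (fu (k, Some (i, j))).
  by apply/eqP; apply: (fu (k, None)).
have pF : polyfun (fun u => \prod_c f c u) by exact: polyfun_prod.
split; first exact: open_polyfun_neq0.
exact/(dense_polyfun_neq0 _ pF)/polyfun_prod_neq0.
Qed.
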